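(* Let $\mathbb K$ be a field of characteristic zero, let $r(n), y(n)\in\mathbb K(n)$ be rational functions with $r(n)\neq 0$ satisfying $$r(n)\,y(n+1)-y(n)=1,$$ and let $$r(n)=\frac{a(n)}{b(n)},\qquad y(n)=\frac{f(n)}{g(n)}$$ be their reduced rational representations, where $a,b,f,g\in\mathbb K[n]$. Let $$k_0=\max\{k\in\mathbb N \mid \deg\gcd(a(n-1),b(n+k))\ge 1\},$$ with $k_0=-1$ if no such $k$ exists, and for $k\ge 0$ let $$G_k(n)=\gcd\bigl(b(n)b(n+1)\cdots b(n+k-1),\; a(n-1)a(n-2)\cdots a(n-k)\bigr).$$ Then $g(n)\mid G_{k_0+1}(n)$ in $\mathbb K[n]$.
   Context: $\mathbb N$ is the set of nonnegative integers. The gcd of two polynomials in $\mathbb K[n]$ is normalized to be monic. A reduced rational representation of a rational function $r(n)$ is an expression $r(n)=a(n)/b(n)$ with $a(n),b(n)\in\mathbb K[n]$, $b(n)\ne 0$, and $\gcd(a(n),b(n))=1$. Empty products equal $1$, so $G_0(n)=1$. The equation arises from Gosper's summation problem $z_{n+1}-z_n=t_n$, where $t_n$ and $z_n$ are (nonzero) hypergeometric terms over $\mathbb K$, by setting $r(n)=t_{n+1}/t_n$ and $y(n)=z_n/t_n$. *)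

(* Defs.v *)
From HB Require Import structures.
From mathcomp Require Import all_boot all_order all_algebra.
Set Implicit Arguments.
Unset Strict Implicit.
Unset Printing Implicit Defensive.
Import GRing.Theory.
Local Open Scope ring_scope.
Local Open Scope quotient_scope.
Local Notation "x %:F" := (tofrac x).

(* p(n) |-> p(n + c) *)
Definition pshift (K : fieldType) (c : K) (p : {poly K}) : {poly K} :=
  p \Po ('X + c%:P).

(* u(n) |-> u(n + c) on K(n) = {fraction {poly K}}, computed on the canonical
   representative of u; fracshift_div shows that any other fraction gives the
   same result. *)
Definition fracshift (K : fieldType) (c : K) (u : {fraction {poly K}}) :
    {fraction {poly K}} :=
  (pshift c \n_(repr u))%:F / (pshift c \d_(repr u))%:F.

(* MathComp's gcdp is only determined up to a nonzero constant. *)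
Definition mgcdp (K : fieldType) (p q : {poly K}) : {poly K} :=
  (lead_coef (gcdp p q))^-1 *: gcdp p q.

Definition reduced_repr (K : fieldType) (u : {fraction {poly K}})
    (p q : {poly K}) : Prop :=
  [/\ q != 0, mgcdp p q = 1 & u = p%:F / q%:F].

(* deg gcd(a(n-1), b(n+k)) >= 1; recall that size p = deg p + 1 for p != 0. *)
Definition common_shift (K : fieldType) (a b : {poly K}) (k : nat) : bool :=
  (1 < size (mgcdp (pshift (-1) a) (pshift k%:R b)))%N.

(* k0 = max {k | common_shift a b k}, or -1 if that set is empty. *)
Definition is_k0 (K : fieldType) (a b : {poly K}) (k0 : int) : Prop :=
  (exists k : nat, [/\ k0 = k%:Z, common_shift a b k &
     forall j : nat, common_shift a b j -> (j <= k)%N])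
  \/ (k0 = -1 /\ forall k : nat, ~~ common_shift a b k).

Definition G (K : fieldType) (a b : {poly K}) (k : nat) : {poly K} :=
  mgcdp (\prod_(0 <= i < k) pshift i%:R b)
        (\prod_(1 <= i < k.+1) pshift (- i%:R) a).

Lemma pshift_eq0 (K : fieldType) (c : K) (p : {poly K}) :
  (pshift c p == 0) = (p == 0).
Proof. by rewrite -!size_poly_eq0 /pshift size_comp_poly2 // size_XaddC. Qed.

Lemma frac_repr (R : idomainType) (u : {fraction R}) :
  u = (\n_(repr u))%:F / (\d_(repr u))%:F.
Proof.
rewrite -[LHS]reprK; unlock tofrac; set x := repr u.
rewrite -[X in _ = _ * X]FracField.pi_inv -[RHS]FracField.pi_mul.
rewrite /FracField.mulf /FracField.invf.
rewrite !numden_Ratio ?oner_neq0 ?denom_ratioP //.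
by rewrite mulr1 mul1r Ratio_numden.
Qed.

Lemma fracshift_div (K : fieldType) (c : K) (p q : {poly K}) : q != 0 ->
  fracshift c (p%:F / q%:F) = (pshift c p)%:F / (pshift c q)%:F.
Proof.
move=> q0; rewrite /fracshift; set u := p%:F / q%:F.
have d0 : \d_(repr u) != 0 by apply: denom_ratioP.
have /eqP := frac_repr u.
rewrite {1}/u eqr_div ?tofrac_eq0 // -!tofracM tofrac_eq => /eqP eq_u.
apply/eqP; rewrite eqr_div ?tofrac_eq0 ?pshift_eq0 //.
by rewrite -!tofracM tofrac_eq /pshift -!comp_polyM eq_u.
Qed.

(* Main.v *)
Require Import Defs.
From mathcomp Require Import all_boot all_order all_algebra.
Import GRing.Theory.
Local Open Scope ring_scope.

(** Clearing denominators turns the equation into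
    a(n) f(n+1) g(n) = b(n) g(n+1) (f(n) + g(n)), so that
    g(n) | b(n) g(n+1) and g(n) | a(n-1) g(n-1).  Iterating, g(n) divides
    b(n) ... b(n+k-1) g(n+k) and a(n-1) ... a(n-k) g(n-k), so it suffices that
    g(n) and g(n+k) are coprime for k = k0+1.  In characteristic zero they are
    coprime for arbitrarily large k, since the other k are roots of a resultant.
    Coprimality descends from k+1 to k as long as k > k0: a common divisor of
    g(n) and g(n+k) would divide both b(n+k) and a(n-1). *)

Section Shift.

Set Implicit Arguments.
Unset Strict Implicit.

Variable K : fieldType.
Implicit Types (p q g : {poly K}) (c d : K).

Lemma pshift0 p : pshift 0 p = p.
Proof. by rewrite /pshift polyC0 addr0 comp_polyXr. Qed.

Lemma pshiftD c d p : pshift c (pshift d p) = pshift (c + d) p.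
Proof.
by rewrite /pshift -comp_polyA comp_polyD comp_polyX comp_polyC -addrA -polyCD.
Qed.

Lemma pshiftM c p q : pshift c (p * q) = pshift c p * pshift c q.
Proof. exact: comp_polyM. Qed.

Lemma coprimep_pshift c p q :
  coprimep p q -> coprimep (pshift c p) (pshift c q).
Proof. exact: coprimep_comp_poly. Qed.

Lemma dvdp_pshift c p q : p %| q -> pshift c p %| pshift c q.
Proof. exact: dvdp_comp_poly. Qed.

(** Serves both chains: [c = 1] with [p = b], and [c = -1] with [p] the shift of [a] by -1. *)
Lemma dvdp_prod_pshift c p g (k : nat) : g %| p * pshift c g ->
  g %| (\prod_(0 <= i < k) pshift (c *+ i) p) * pshift (c *+ k) g.
Proof.
move=> g_pg; elim: k => [|k IHk]; first by rewrite big_geq // mul1r pshift0.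
apply: (dvdp_trans IHk); rewrite big_nat_recr //= -mulrA dvdp_mul //.
by have := dvdp_pshift (c *+ k) g_pg; rewrite pshiftM pshiftD -mulrSr.
Qed.

Lemma size_mgcdp p q : size (mgcdp p q) = size (gcdp p q).
Proof.
have [g0|g_neq0] := eqVneq (gcdp p q) 0; first by rewrite /mgcdp g0 scaler0.
by rewrite size_scale // invr_eq0 lead_coef_eq0.
Qed.

Lemma dvdp_mgcdp g p q : g %| p -> g %| q -> g %| mgcdp p q.
Proof. by move=> gp gq; rewrite /mgcdp -mul_polyC dvdp_mull // dvdp_gcd gp. Qed.

(** [sub_annihilant p q] is the resultant in X of p(X + Y) and q(X), hence a combination of the two.
    At Y = [c], a common divisor of [pshift c p] and [q] divides its value, a constant. *)
Lemma root_sub_annihilant c p q : p != 0 -> q != 0 ->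
  ~~ coprimep q (pshift c p) -> root (sub_annihilant p q) c.
Proof.
move=> p0 q0; set d := gcdp q (pshift c p) => not_co.
have d_q : d %| q := dvdp_gcdl _ _; have d_p : d %| pshift c p := dvdp_gcdr _ _.
have d_gt1 : (1 < size d)%N.
  by rewrite ltn_neqAle eq_sym not_co lt0n size_poly_eq0 gcdp_eq0 (negPf q0).
(* [resultant_in_ideal] needs both polynomials nonconstant in X; the nonconstant divisor [d] ensures
   this. *)
have q_gt1 : (1 < size (map_poly polyC q))%N.
  by rewrite size_map_polyC (leq_trans d_gt1) ?dvdp_leq.
have p_gt1 : (1 < size (poly_XaY p))%N.
  rewrite size_poly_XaY -(@size_comp_poly2 _ p ('X + c%:P)) ?size_XaddC //.
  by rewrite (leq_trans d_gt1) // dvdp_leq ?pshift_eq0.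
have eval_p : map_poly (horner_eval c) (poly_XaY p) = pshift c p.
  by rewrite -[LHS]horner_swapXY swapXY_poly_XaY horner_poly_XaY addrC.
have eval_q : map_poly (horner_eval c) (map_poly polyC q) = q.
  by apply/polyP => i; rewrite !coef_map /= /horner_eval hornerC.
have [[u v] /= _ /(congr1 (map_poly (horner_eval c)))] :=
  resultant_in_ideal p_gt1 q_gt1.
rewrite rmorphD !rmorphM /= map_polyC /= eval_p eval_q -/(sub_annihilant p q).
rewrite [horner_eval c _]/(_.[c]) => eqR.
apply: contraLR d_gt1; rewrite -leqNgt => Rc.
apply: leq_trans (size_polyC_leq1 (sub_annihilant p q).[c]).
apply: dvdp_leq; first by rewrite polyC_eq0.
by rewrite eqR addrC dvdp_add // dvdp_mull.
Qed.

Lemma coprimep_pshift_large g (m : nat) : [pchar K] =i pred0 -> g != 0 ->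
  exists2 j : nat, (m <= j)%N & coprimep g (pshift j%:R g).
Proof.
move=> charK g0; set R := sub_annihilant g g.
have R0 : R != 0 by apply: sub_annihilant_neq0.
(* [R] has fewer than [size R] roots, and these [size R] values are distinct in characteristic zero,
   so one is not a root. *)
pose s := [seq (j%:R : K) | j <- iota m (size R)].
have /allPn[c /mapP[j]] : ~~ all (root R) s.
  apply/negP => sR; have := max_poly_roots R0 sR.
  rewrite size_map size_iota ltnn => /(_ _)/notF; apply.
  rewrite map_inj_in_uniq ?iota_uniq // => i j _ _.
  wlog le_ij : i j / (i <= j)%N.
    by have [le_ij|/ltnW le_ji] := leqP i j => wl e;
       [exact: wl | apply/esym/wl].
  move/eqP; rewrite eq_sym -subr_eq0 -natrB // (pcharf0P K).1 // subn_eq0.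
  by move=> le_ji; apply/eqP; rewrite eqn_leq le_ij.
rewrite mem_iota => /andP[le_mj _] -> Rj; exists j => //.
by apply: contraNT Rj; apply: root_sub_annihilant.
Qed.

Lemma coprimep_pshift_ge a b g (m : nat) :
  [pchar K] =i pred0 -> b != 0 -> g != 0 ->
  g %| b * pshift 1 g -> g %| pshift (-1) a * pshift (-1) g ->
  (forall j : nat, (m <= j)%N -> ~~ common_shift a b j) ->
  coprimep g (pshift m%:R g).
Proof.
move=> charK b0 g0 g_b g_a ncs.
have [j /subnKC<-] := coprimep_pshift_large m charK g0.
(* Descends from the large shift [j] to [m], one unit at a time. *)
elim: (j - m)%N => [|k IHk]; first by rewrite addn0.
rewrite addnS => co_S; apply: IHk.
have := ncs (m + k)%N (leq_addr _ _).
set i := (m + k)%N in co_S *; rewrite /common_shift size_mgcdp => /negP ncs_i.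
apply/coprimepP => d dg dgi; rewrite -size_poly_eq1.
(* [d] divides g(n+i), which divides b(n+i) g(n+i+1), and is coprime to the last factor since it
   divides g. *)
have d_b : d %| pshift i%:R b.
  rewrite -(@Gauss_dvdpl _ _ (pshift i.+1%:R g));
    last exact: coprimep_dvdr co_S.
  rewrite -addn1 natrD -pshiftD -pshiftM.
  exact/(dvdp_trans dgi)/dvdp_pshift.
(* Shifting [co_S] by -1 makes g(n-1) coprime to g(n+i), hence to [d]. *)
have d_a : d %| pshift (-1) a.
  rewrite -(@Gauss_dvdpl _ _ (pshift (-1) g)); first exact: dvdp_trans g_a.
  apply: (coprimep_dvdr dgi); rewrite coprimep_sym.
  by have := coprimep_pshift (-1) co_S; rewrite pshiftD mulrS addKr.
have d0 : d != 0 by apply: contraNneq g0 => d0; rewrite -dvd0p -d0.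
have h0 : gcdp (pshift (-1) a) (pshift i%:R b) != 0.
  by rewrite gcdp_eq0 [X in _ && X]pshift_eq0 (negPf b0) andbF.
rewrite eqn_leq lt0n size_poly_eq0 d0 andbT leqNgt; apply/negP => d1.
apply: ncs_i; apply: leq_trans d1 _; apply: dvdp_leq => //.
by rewrite dvdp_gcd d_a.
Qed.

End Shift.

Theorem theorem2p2 (K : fieldType) (charK : [pchar K] =i pred0)
    (r y : {fraction {poly K}}) (a b f g : {poly K}) (k0 : int) :
  r != 0 ->
  r * fracshift 1 y - y = 1 ->
  reduced_repr r a b ->
  reduced_repr y f g ->
  is_k0 a b k0 ->
  (* k0 >= -1, so absz only casts k0 + 1 to nat *)
  g %| G a b (absz (k0 + 1)).
Proof.
move=> _ eq_ry [b0 _ def_r] [g0 co_fg def_y] k0P; set m := absz (k0 + 1).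
(* If k0 = -1 then [m] is 0, and all shifts are covered. *)
have {k0P} ncs j : (m <= j)%N -> ~~ common_shift a b j.
  rewrite /m; case: k0P => [[k [-> _ max_k]] | [_ ncs] _]; last exact: ncs.
  rewrite -PoszD absz_nat addn1 => lt_kj.
  by apply/negP => /max_k; rewrite leqNgt lt_kj.
have {co_fg} co_gf : coprimep g f.
  by rewrite coprimep_sym /coprimep -size_mgcdp co_fg size_poly1.
have g1_neq0 : pshift 1 g != 0 by rewrite pshift_eq0.
have eq_poly : a * pshift 1 f * g = b * pshift 1 g * (f + g).
  move/(canRL (subrK _)): eq_ry; rewrite def_r def_y fracshift_div //.
  have gF0 : tofrac g != 0 by rewrite tofrac_eq0.
  rewrite -(divff gF0) -mulrDl mulf_div -!tofracM -tofracD => /eqP.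
  rewrite eqr_div ?tofrac_eq0 ?mulf_neq0 // -!tofracM tofrac_eq => /eqP ->.
  by rewrite [g + f]addrC mulrC.
have g_b : g %| b * pshift 1 g.
  rewrite -(@Gauss_dvdpl _ _ (f + g)) -?eq_poly ?dvdp_mulIr //.
  by rewrite addrC -[X in X + f]mul1r coprimep_addl_mul.
have g_a : g %| pshift (-1) a * pshift (-1) g.
  (* g(n+1) is coprime to f(n+1), which can be cancelled before shifting back. *)
  have /(dvdp_pshift (-1)) : pshift 1 g %| a * g.
    rewrite -(@Gauss_dvdpl _ _ (pshift 1 f)) ?coprimep_pshift //.
    by rewrite mulrAC eq_poly -mulrA mulrCA dvdp_mulr.
  by rewrite pshiftD addNr pshift0 pshiftM.
have co_g := coprimep_pshift_ge charK b0 g0 g_b g_a ncs.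
have co_gN : coprimep g (pshift (- m%:R) g).
  rewrite coprimep_sym.
  by have := coprimep_pshift (- m%:R) co_g; rewrite pshiftD addNr pshift0.
apply: dvdp_mgcdp.
  rewrite -(Gauss_dvdpl _ co_g).
  exact: dvdp_prod_pshift.
rewrite -(Gauss_dvdpl _ co_gN) big_add1 /=.
have := dvdp_prod_pshift m g_a; rewrite mulNrn.
under eq_bigr do rewrite pshiftD mulNrn -opprD -mulrSr.
by [].
Qed.
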